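(* Let $\{\alpha_1,\alpha_2,\dots,\alpha_n\}$ be a trace-orthogonal basis of $GF(2^n)$ over $GF(2)$, and let $\Gamma$ be the $[n,k,d]_{2^n}$ MRD code generated by the $k\times n$ matrix $G=\left[\alpha_j^{2^i}\right]_{i=0,\dots,k-1;\ j=1,\dots,n}$, where $1\le k\le n$. Then $\Gamma$ is an LCD code.
   Context: The trace function $\mathrm{tr}:GF(2^n)\to GF(2)$ is $\mathrm{tr}(a)=\sum_{j=0}^{n-1}a^{2^j}$. A basis $\{b_1,\dots,b_n\}$ of $GF(2^n)$ over $GF(2)$ is trace-orthogonal if it equals its own dual basis, i.e. $\mathrm{tr}(b_ib_j)=\delta_{ij}$ for all $1\le i,j\le n$. An $[n,k,d]_{2^n}$ MRD code is a $k$-dimensional $GF(2^n)$-linear code of length $n$ whose minimum rank distance (minimum over nonzero codewords of the dimension of the $GF(2)$-span of the coordinates) is $d=n-k+1$; the row space of $G$ over $GF(2^n)$ is such a code. For a linear code $\Gamma\subseteq F^n$, the dual $\Gamma^\perp$ consists of all $v\in F^n$ with $\sum_i u_iv_i=0$ for all $u\in\Gamma$. $\Gamma$ is an LCD code (linear code with complementary dual) if $\Gamma\cap\Gamma^\perp=\{0\}$. *)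

(* Defs.v *)
From HB Require Import structures.
From mathcomp Require Import all_boot all_order all_algebra all_field.

Set Implicit Arguments.
Unset Strict Implicit.
Unset Printing Implicit Defensive.

Import GRing.Theory.
Local Open Scope ring_scope.

(* A finite field GF(2^n) is a field extension L of 'F_2 with \dim {:L} = n;
   the vspaces of L are its GF(2)-subspaces. *)

(* Takes its values in the prime subfield {0, 1} of L, identified with GF(2). *)
Definition abs_trace (L : fieldExtType 'F_2) (a : L) : L :=
  \sum_(j < \dim {:L}) a ^+ (2 ^ j).

Definition trace_orthogonal_basis (L : fieldExtType 'F_2) (n : nat)
    (b : n.-tuple L) : Prop :=
  basis_of {:L} b /\
  (forall i j : 'I_n, abs_trace (tnth b i * tnth b j) = (i == j)%:R).

Definition row_code (F : fieldType) (k n : nat) (G : 'M[F]_(k, n)) :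
    {vspace 'rV[F]_n} :=
  <<[seq row i G | i : 'I_k]>>%VS.

Definition in_dual_code (F : fieldType) (n : nat) (C : {vspace 'rV[F]_n})
    (v : 'rV[F]_n) : Prop :=
  forall u : 'rV[F]_n, u \in C -> \sum_(i < n) u 0 i * v 0 i = 0.

Definition LCD (F : fieldType) (n : nat) (C : {vspace 'rV[F]_n}) : Prop :=
  forall v : 'rV[F]_n, (v \in C /\ in_dual_code C v) <-> v = 0.

Definition rank_weight (L : fieldExtType 'F_2) (n : nat) (v : 'rV[L]_n) : nat :=
  \dim <<[seq v ord0 i | i : 'I_n]>>%VS.

Definition min_rank_distance (L : fieldExtType 'F_2) (n : nat)
    (C : {vspace 'rV[L]_n}) (d : nat) : Prop :=
  (exists v : 'rV[L]_n, [/\ v \in C, v != 0 & rank_weight v = d]) /\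
  (forall v : 'rV[L]_n, v \in C -> v != 0 -> (d <= rank_weight v)%N).

Definition MRD_code (L : fieldExtType 'F_2) (n k d : nat)
    (C : {vspace 'rV[L]_n}) : Prop :=
  [/\ \dim C = k, min_rank_distance C d & d = (n - k + 1)%N].

Definition gabidulin_mx (L : fieldExtType 'F_2) (k n : nat)
    (b : n.-tuple L) : 'M[L]_(k, n) :=
  \matrix_(i < k, j < n) tnth b j ^+ (2 ^ i).

(* Main.v *)
(* For a trace-orthogonal basis the full n x n Moore matrix M is orthogonal:
   the (i, j) entry of M^T M is tr(alpha_i alpha_j), so M^T M = 1 and hence
   M M^T = 1. Thus the rows of the generator matrix G, being k of the rows of M,
   are orthonormal for the standard bilinear form. A codeword v satisfies
   v = (v G^T) G, and v G^T = 0 when v lies in the dual code. *)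
Require Import Defs.
From HB Require Import structures.
From mathcomp Require Import all_boot all_order all_algebra all_field.
Import GRing.Theory.
Local Open Scope ring_scope.

Lemma row_mem_row_code {F : fieldType} {k n : nat} (G : 'M[F]_(k, n))
    (i : 'I_k) : row i G \in row_code G.
Proof. by rewrite memv_span // image_f. Qed.

Lemma row_code_orthonormalE {F : fieldType} {k n : nat} {G : 'M[F]_(k, n)}
    {v : 'rV[F]_n} :
  G *m G^T = 1%:M -> v \in row_code G -> v = v *m G^T *m G.
Proof.
(* The kernel of [f] is the space of vectors fixed by [v |-> v *m G^T *m G]. Being a subspace, it
   contains the whole code as soon as it contains each row of [G]. *)
move=> GG1 vG; pose f := linfun (mulmxr (G^T *m G - 1%:M) : 'rV[F]_n -> 'rV[F]_n).
have /subvP/(_ _ vG) : (row_code G <= lker f)%VS.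
  apply/span_subvP => _ /imageP[i _ ->].
  by rewrite memv_ker lfunE /= -row_mul mulmxBr mulmx1 mulmxA GG1 mul1mx subrr row0.
rewrite memv_ker lfunE /= mulmxBr mulmx1 mulmxA subr_eq0.
by move=> /eqP.
Qed.

Lemma row_code_orthonormal_LCD {F : fieldType} {k n : nat} (G : 'M[F]_(k, n)) :
  G *m G^T = 1%:M -> LCD (row_code G).
Proof.
move=> GG1 v; split=> [[vG vdual] | ->]; last first.
  by split=> [|u _]; [rewrite mem0v | rewrite big1 // => i _; rewrite mxE mulr0].
rewrite (row_code_orthonormalE GG1 vG).
suff ->: v *m G^T = 0 by rewrite mul0mx.
(* Entry [i] of [v *m G^T] is the pairing of [v] with row [i] of [G], itself a codeword. *)
apply/rowP=> i; rewrite !mxE -[RHS](vdual _ (row_mem_row_code G i)).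
by apply: eq_bigr => j _; rewrite !mxE mulrC.
Qed.

Lemma moore_mx_orthogonal {L : fieldExtType 'F_2} {n : nat} {b : n.-tuple L} :
  \dim {:L} = n -> trace_orthogonal_basis b ->
  gabidulin_mx n b *m (gabidulin_mx n b)^T = 1%:M.
Proof.
move=> dimL [_ b_orth]; apply: mulmx1C; apply/matrixP=> i j.
rewrite !mxE -b_orth /abs_trace dimL.
by apply: eq_bigr => l _; rewrite !mxE exprMn.
Qed.

Lemma gabidulin_mx_orthonormal {L : fieldExtType 'F_2} {k n : nat}
    {b : n.-tuple L} :
  (k <= n)%N -> \dim {:L} = n -> trace_orthogonal_basis b ->
  gabidulin_mx k b *m (gabidulin_mx k b)^T = 1%:M.
Proof.
move=> le_kn dimL b_orth; apply/matrixP=> i j.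
(* The Gram matrix of the first [k] Moore rows is the top left block of the full one; [widen_ord]
   keeps values, hence both the exponents [2 ^ i] and the test [i == j]. *)
have /matrixP/(_ (widen_ord le_kn i) (widen_ord le_kn j)) :=
  moore_mx_orthogonal dimL b_orth.
rewrite !mxE -[RHS]/((i == j)%:R) => <-.
by apply: eq_bigr => l _; rewrite !mxE.
Qed.

Theorem theorem4p4p1p1 (n k d : nat) (L : fieldExtType 'F_2)
    (hL : \dim {:L} = n) (alpha : n.-tuple L)
    (halpha : trace_orthogonal_basis alpha)
    (hk : (1 <= k <= n)%N) (Gamma : {vspace 'rV[L]_n})
    (hG : Gamma = row_code (gabidulin_mx k alpha))
    (hMRD : MRD_code k d Gamma) :
  LCD Gamma.
Proof.
rewrite hG; apply: row_code_orthonormal_LCD.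
by case/andP: hk => _ le_kn; apply: gabidulin_mx_orthonormal.
Qed.
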